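(* For $n\ge2$, as virtual $S_n$-characters, $$\sum_{i\ge0}(-1)^i\,\widehat W^i_n=(-1)^{n-1}\chi^{(2,1^{n-2})}.$$
   Context: Let $C_n\subset S_n$ be generated by an $n$-cycle $c$, $\chi_\zeta$ a linear character of $C_n$ sending $c$ to a primitive $n$-th root of unity, $\mathrm{Lie}_{(n)}=\chi_\zeta\uparrow_{C_n}^{S_n}$, $\pi_n=\omega(\mathrm{ch}(\mathrm{Lie}_{(n)}))$ where $\mathrm{ch}$ is the Frobenius characteristic and $\omega$ the standard involution. For $\lambda=1^{m_1}2^{m_2}\cdots$ define $W_\lambda$ by $\mathrm{ch}(W_\lambda)=\prod_{j\text{ odd}}h_{m_j}[\pi_j]\prod_{j\text{ even}}e_{m_j}[\pi_j]$ (plethysm); $\mathrm{rank}(\lambda)=|\lambda|-\ell(\lambda)$. $\widehat W^i_n=\bigoplus_\lambda W_\lambda$ over partitions $\lambda$ of $n$ with no part equal to $1$ and rank $i$. $\chi^\mu$ denotes the irreducible $S_n$-character indexed by $\mu$. *)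

(* Defs.v *)
From HB Require Import structures.
From mathcomp Require Import all_boot all_order all_algebra all_fingroup all_solvable all_field all_character.
Set Implicit Arguments. Unset Strict Implicit. Unset Printing Implicit Defensive.
Import GRing.Theory Num.Theory.

Fixpoint parts_le (fuel n k : nat) : seq (seq nat) :=
  match fuel with
  | 0 => if n == 0 then [:: [::]] else [::]
  | fuel'.+1 =>
      if n == 0 then [:: [::]] else
      flatten [seq [seq i :: l | l <- parts_le fuel' (n - i) i]
              | i <- iota 1 (minn n k)]
  end.
Definition partitions (n : nat) : seq (seq nat) := parts_le n n n.

Definition zee (rho : seq nat) : nat :=
  \prod_(i <- undup rho) (i ^ count_mem i rho * (count_mem i rho)`!).

Definition rank (la : seq nat) : nat := sumn la - size la.

Definition cycletype n (s : 'S_n) : seq nat :=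
  sort geq (map (fun X : {set 'I_n} => #|X|) (enum (porbits s))).

Local Open Scope ring_scope.

(* ---------- symmetric functions over algC in the power-sum basis ----------
   A symmetric function is a finite formal sum  sum_k c_k p_{mu_k},
   represented by the list of pairs (c_k, mu_k).  Two such are equal iff
   they have the same coefficient on every p_mu (p_mu basis). *)
Definition symf := seq (algC * seq nat).
Definition sf_coef (f : symf) (mu : seq nat) : algC :=
  \sum_(x <- f | perm_eq x.2 mu) x.1.
Definition sf_eq (f g : symf) : Prop := forall mu, sf_coef f mu = sf_coef g mu.

Definition sf0 : symf := [::].
Definition sf1 : symf := [:: (1, [::])].
Definition sf_p (mu : seq nat) : symf := [:: (1, mu)].
Definition sf_add (f g : symf) : symf := f ++ g.
Definition sf_sum (fs : seq symf) : symf := flatten fs.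
Definition sf_scale (a : algC) (f : symf) : symf := [seq (a * x.1, x.2) | x <- f].
Definition sf_mul (f g : symf) : symf :=
  [seq (x.1 * y.1, sort geq (x.2 ++ y.2)) | x <- f, y <- g].
Definition sf_prod (fs : seq symf) : symf := foldr sf_mul sf1 fs.

Definition sf_omega (f : symf) : symf :=
  [seq ((-1) ^+ rank x.2 * x.1, x.2) | x <- f].

Definition p_pleth (k : nat) (F : symf) : symf :=
  [seq (x.1, [seq (k * a)%N | a <- x.2]) | x <- F].

Definition h_pleth (m : nat) (F : symf) : symf :=
  sf_sum [seq sf_scale ((zee rho)%:R^-1) (sf_prod [seq p_pleth k F | k <- rho])
         | rho <- partitions m].
Definition e_pleth (m : nat) (F : symf) : symf :=
  sf_sum [seq sf_scale ((-1) ^+ rank rho / (zee rho)%:R)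
                       (sf_prod [seq p_pleth k F | k <- rho])
         | rho <- partitions m].

Definition sf_h (m : nat) : symf := h_pleth m (sf_p [:: 1%N]).
Definition sf_h_diff (a b : nat) : symf := if (a < b)%N then sf0 else sf_h (a - b).

(* Schur function via Jacobi-Trudi: s_mu = det (h_{mu_i - i + j}) *)
Definition schur (mu : seq nat) : symf :=
  let k := size mu in
  sf_sum [seq sf_scale ((-1) ^+ odd_perm s)
           (sf_prod [seq sf_h_diff (nth 0%N mu i + s i) i | i : 'I_k <- enum 'I_k])
         | s : 'S_k <- enum 'S_k].

Definition frob n (chi : 'CF([set: 'S_n])) : symf :=
  [seq (chi s / (n`!)%:R, cycletype s) | s <- enum 'S_n].

Unset Implicit Arguments.

(* Lie_(j) = Ind_{C_j}^{S_j} chi_zeta, for a j-cycle c j and a linear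
   character chi j of <[c j]>;  pi_j = omega(ch(Lie_(j))) *)
Definition Lie (c : forall j, 'S_j) (chi : forall j, 'CF(<[c j]>)) (j : nat)
  : 'CF([set: 'S_j]) := 'Ind[[set: 'S_j]] (chi j).
Definition pi_sf (c : forall j, 'S_j) (chi : forall j, 'CF(<[c j]>)) (j : nat) : symf := sf_omega (frob (Lie c chi j)).

Definition chW (c : forall j, 'S_j) (chi : forall j, 'CF(<[c j]>)) (n : nat) (la : seq nat) : symf :=
  sf_prod [seq (if odd j then h_pleth else e_pleth) (count_mem j la) (pi_sf c chi j)
          | j <- iota 1 n].

Definition chWhat (c : forall j, 'S_j) (chi : forall j, 'CF(<[c j]>)) (n i : nat) : symf :=
  sf_sum [seq chW c chi n la
         | la <- partitions n & (1%N \notin la) && (rank la == i)].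

(* Main.v *)
(* Evaluate symmetric functions at p_i = x_i, with a grading variable t.  Since
   pi_j = (1/j) sum_(d | j) mu(d) (-1)^(j - j/d) p_d^(j/d), the signed sum over
   all partitions, sum_la (-1)^rank(la) ch(W_la) t^|la|, is a product over j of
   plethysms whose logarithms add up to
   sum_N (1/N) log(1 + p_N t^N) sum_(d | N) mu(d) = log(1 + p_1 t).
   So the full sum is 1 + p_1 t; omitting the factor j = 1, which is
   sum_m h_m t^m, leaves (1 + p_1 t) sum_m (-1)^m e_m t^m.  Its coefficient of
   t^n is (-1)^(n-1) (e_1 e_(n-1) - e_n), the signed hook Schur function.
   Logarithms are replaced by logarithmic derivatives, truncated at order n. *)
Require Import Defs.
From HB Require Import structures.
From mathcomp Require Import all_boot all_order all_algebra all_fingroup all_solvable all_field all_character.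
From mathcomp Require Import ring.
Import GRing.Theory Num.Theory.
Local Open Scope ring_scope.
Set Implicit Arguments.
Unset Strict Implicit.

(** * Evaluation of symmetric functions *)

Definition sf_eval (x : nat -> algC) (f : symf) : algC :=
  \sum_(u <- f) u.1 * \prod_(i <- u.2) x i.

Lemma sf_eval_cat x f g : sf_eval x (f ++ g) = sf_eval x f + sf_eval x g.
Proof. by rewrite /sf_eval big_cat. Qed.

Lemma sf_eval_scale x a f : sf_eval x (sf_scale a f) = a * sf_eval x f.
Proof.
by rewrite /sf_eval big_map mulr_sumr; apply: eq_bigr => u _; rewrite mulrA.
Qed.

Lemma sf_eval_sum (T : Type) x (s : seq T) (F : T -> symf) :
  sf_eval x (sf_sum [seq F i | i <- s]) = \sum_(i <- s) sf_eval x (F i).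
Proof.
elim: s => [|i s IHs]; first by rewrite /sf_eval !big_nil.
by rewrite big_cons -IHs -sf_eval_cat.
Qed.

Lemma sf_eval_mul x f g : sf_eval x (sf_mul f g) = sf_eval x f * sf_eval x g.
Proof.
rewrite /sf_eval /sf_mul big_allpairs_dep mulr_suml; apply: eq_bigr => u _.
rewrite mulr_sumr; apply: eq_bigr => v _ /=.
rewrite (perm_big (u.2 ++ v.2)) /=; last by rewrite perm_sort.
by rewrite big_cat mulrACA.
Qed.

Lemma sf_eval_prod (T : Type) x (s : seq T) (F : T -> symf) :
  sf_eval x (sf_prod [seq F i | i <- s]) = \prod_(i <- s) sf_eval x (F i).
Proof.
elim: s => [|i s IHs]; first by rewrite /sf_eval /= big_seq1 !big_nil mulr1.
by rewrite big_cons -IHs -sf_eval_mul.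
Qed.

Lemma sf_eval_p_pleth x k f :
  sf_eval x (p_pleth k f) = sf_eval (fun i => x (k * i)%N) f.
Proof.
by rewrite /sf_eval big_map; apply: eq_bigr => u _; rewrite big_map.
Qed.

(** Reduction modulo [B] recovers the lowest digit; cancelling it and dividing by [B] leaves one
    digit fewer. *)
Lemma base_digits_inj B M (a b : nat -> nat) :
    (forall i, a i < B)%N -> (forall i, b i < B)%N ->
    (\sum_(i < M) a i * B ^ i = \sum_(i < M) b i * B ^ i)%N ->
  forall i, (i < M)%N -> a i = b i.
Proof.
elim: M a b => [|M IHM] a b ltaB ltbB //.
have shift (c : nat -> nat) : (\sum_(i < M.+1) c i * B ^ i
    = (\sum_(i < M) c i.+1 * B ^ i) * B + c 0)%N.
  rewrite big_ord_recl muln1 addnC big_distrl /=; congr (_ + _)%N.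
  by apply: eq_bigr => i _; rewrite /bump /= expnSr mulnA.
have B0 : (0 < B)%N by apply: leq_ltn_trans (ltaB 0%N).
rewrite !shift => eqab.
have eq0 : a 0%N = b 0%N.
  by move/(congr1 (modn^~ B)): eqab; rewrite !modnMDl !modn_small.
move: eqab; rewrite eq0 => /eqP; rewrite eqn_add2r eqn_pmul2r // => /eqP eqab.
case=> [|i] //; rewrite ltnS => ltiM.
exact: (IHM (fun i => a i.+1) (fun i => b i.+1)).
Qed.

(** The multiplicity of [i] in [s] is the [i]-th base-[B] digit of the sum; the size bounds exclude
    carries. *)
Lemma sum_expn_perm_eq (B : nat) (s t : seq nat) :
    (size s < B)%N -> (size t < B)%N ->
    (\sum_(i <- s) B ^ i = \sum_(i <- t) B ^ i)%N -> perm_eq s t.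
Proof.
move=> ltsB lttB.
pose M := (\max_(i <- s ++ t) i).+1.
have ltM i : i \in s ++ t -> (i < M)%N by move=> ?; rewrite ltnS leq_bigmax_seq.
have digits u : {subset u <= s ++ t} ->
    (\sum_(i <- u) B ^ i = \sum_(i < M) count_mem (i : nat) u * B ^ i)%N.
  elim: u => [_|i u IHu sub] /=; first by rewrite big_nil big1.
  rewrite big_cons IHu; last by move=> j uj; rewrite sub // in_cons uj orbT.
  rewrite (eq_bigr (fun j : 'I_M => (i == j) * B ^ j + count_mem (j : nat) u * B ^ j)%N);
    last by move=> j _; rewrite mulnDl.
  rewrite big_split /=; congr (_ + _)%N.
  have iM : (i < M)%N by rewrite ltM // sub // mem_head.
  rewrite (bigD1 (Ordinal iM)) //= eqxx mul1n big1 ?addn0 // => j.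
  by rewrite -val_eqE /= eq_sym => /negbTE->.
rewrite !digits; last 2 first.
- by move=> i ti; rewrite mem_cat ti orbT.
- by move=> i si; rewrite mem_cat si.
move/(@base_digits_inj B M (fun j => count_mem j s) (fun j => count_mem j t)) => eq_digits.
apply/allP => i sti; apply/eqP/eq_digits; last exact: ltM.
  by move=> j; apply: leq_ltn_trans (count_size _ _) ltsB.
by move=> j; apply: leq_ltn_trans (count_size _ _) lttB.
Qed.

(** In characteristic 0 the naturals below [size p] are distinct, and they are one root too many for
    a nonzero [p]. *)
Lemma poly_horner_eq0 (F : numFieldType) (p : {poly F}) :
  (forall z, p.[z] = 0) -> p = 0.
Proof.
move=> p0; apply/eqP; apply: contraT => nz_p.
have := @max_poly_roots _ p [seq i%:R | i <- iota 0 (size p)] nz_p.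
rewrite size_map size_iota ltnn => ->//.
  by apply/allP => z _; rewrite /root p0.
by rewrite map_inj_uniq ?iota_uniq // => i j /eqP; rewrite eqr_nat => /eqP.
Qed.

(* Kronecker substitution: p_i = z ^ (B ^ i) separates the monomials p_mu with
   size mu < B. *)
Lemma sf_eq_eval f g : (forall x, sf_eval x f = sf_eval x g) -> sf_eq f g.
Proof.
move=> eqfg mu; pose h := f ++ sf_scale (-1) g.
have h0 x : sf_eval x h = 0.
  by rewrite sf_eval_cat sf_eval_scale eqfg mulN1r subrr.
suff: sf_coef h mu = 0.
  rewrite /sf_coef big_cat big_map /= -big_distrr /= mulN1r.
  by move/eqP; rewrite subr_eq0 => /eqP.
pose B := (\max_(nu <- mu :: [seq u.2 | u <- h]) size nu).+1.
have ltB nu : nu \in mu :: [seq u.2 | u <- h] -> (size nu < B)%N.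
  by move=> ?; rewrite ltnS leq_bigmax_seq.
pose K nu := (\sum_(i <- nu) B ^ i)%N.
pose p : {poly algC} := \sum_(u <- h) u.1 *: 'X^(K u.2).
have p0 : p = 0.
  apply: poly_horner_eq0 => z; rewrite -[RHS](h0 (fun i => z ^+ (B ^ i))).
  rewrite horner_sum; apply: eq_bigr => u _.
  by rewrite hornerZ hornerXn /K expr_sum.
have := congr1 (fun q : {poly algC} => q`_(K mu)) p0.
rewrite coef0 coef_sum => <-; rewrite /sf_coef big_mkcond big_seq [RHS]big_seq.
apply: eq_bigr => u hu; rewrite coefZ coefXn.
have -> : perm_eq u.2 mu = (K mu == K u.2).
  apply/idP/eqP => [eq_mu | /esym]; first by rewrite /K (perm_big _ eq_mu).
  apply: sum_expn_perm_eq; apply: ltB; last exact: mem_head.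
  by rewrite in_cons map_f ?orbT.
by case: eqP; rewrite ?mulr1 ?mulr0.
Qed.

(** * Generating functions over partitions *)

Lemma iota1S n : iota 1 n.+1 = iota 1 n ++ [:: n.+1].
Proof. by rewrite -(addn1 n) iotaD add1n addn1. Qed.

Lemma mem_parts_le fuel n k la :
  la \in parts_le fuel n k -> sumn la = n /\ {in la, forall i, 0 < i <= k}%N.
Proof.
elim: fuel n k la => [|fuel IH] n k la /=.
  by case: eqVneq => // ->; rewrite inE => /eqP->.
case: eqVneq => [-> | _]; first by rewrite inE => /eqP->.
case/flattenP => _ /mapP[i + ->] /mapP[l /IH[sum_l in_l] ->].
rewrite mem_iota add1n ltnS leq_min => /and3P[i0 le_in le_ik].
split=> [|j] /=; first by rewrite sum_l subnKC.
rewrite inE => /predU1P[->|/in_l/andP[-> /leq_trans->//]].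
by rewrite i0.
Qed.

(** Parts are positive, so each recursive call lowers [n] by at least one and fuel [n] suffices. *)
Lemma parts_le_fuel fuel fuel' n k :
  (n <= fuel)%N -> (n <= fuel')%N -> parts_le fuel n k = parts_le fuel' n k.
Proof.
elim: fuel fuel' n k => [|fuel IH] [|fuel'] n k //=.
- by rewrite leqn0 => ->.
- by move=> _; rewrite leqn0 => ->.
case: (eqVneq n 0%N) => // n0 le_n le_n'; congr flatten; apply/eq_in_map => i.
rewrite mem_iota add1n ltnS leq_min => /and3P[i0 le_in _].
have le_sub m : (n <= m.+1)%N -> (n - i <= m)%N.
  by move=> le_nm; rewrite leq_subLR (leq_trans le_nm) // -add1n leq_add2r.
by congr map; apply: IH; apply: le_sub.
Qed.

Lemma parts_le_stable fuel n k k' :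
  (n <= k)%N -> (n <= k')%N -> parts_le fuel n k = parts_le fuel n k'.
Proof. by case: fuel => //= fuel /minn_idPl-> /minn_idPl->. Qed.

(** Parts are listed in weakly decreasing order, so the new partitions are those that start with
    [k.+1]. *)
Lemma parts_leS fuel n k : (n <= fuel)%N ->
  parts_le fuel n k.+1 = parts_le fuel n k ++
    (if (k < n)%N then [seq k.+1 :: l | l <- parts_le fuel (n - k.+1) k.+1] else [::]).
Proof.
move=> le_n; case: ltnP => [lt_kn | le_nk]; last first.
  by rewrite cats0; apply: parts_le_stable; rewrite // ltnW.
case: fuel le_n => [|fuel] le_n; first by case: n lt_kn le_n.
have n0 : n != 0%N by case: n lt_kn {le_n}.
have le_sub : (n - k.+1 <= fuel)%N.
  by rewrite leq_subLR (leq_trans le_n) // addSn ltnS leq_addl.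
rewrite (@parts_le_fuel fuel.+1 fuel (n - k.+1)) //; last exact: leqW.
rewrite [parts_le fuel.+1 n k.+1]/= [parts_le fuel.+1 n k]/= (negbTE n0).
rewrite (minn_idPr lt_kn) (minn_idPr (ltnW lt_kn)).
by rewrite iota1S map_cat flatten_cat /= cats0.
Qed.

Section PartitionSeries.
Variable R : comNzRingType.

(** Here [m] is the multiplicity of the part [k.+1]. Induction on [M] peels off one copy at a time,
    and [n < M] leaves room for every possible multiplicity. *)
Lemma sum_parts_leS (M fuel n k : nat) (Phi : seq nat -> R) :
    (n <= fuel)%N -> (n < M)%N ->
  \sum_(la <- parts_le fuel n k.+1) Phi la =
    \sum_(m < M | (m * k.+1 <= n)%N)
      \sum_(la <- parts_le fuel (n - m * k.+1) k) Phi (nseq m k.+1 ++ la).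
Proof.
elim: M n Phi => // M IHM n Phi le_n; rewrite ltnS => lt_nM.
rewrite parts_leS // big_cat [in RHS]big_mkcond big_ord_recl /= mul0n subn0.
congr (_ + _); case: ltnP => [lt_kn | le_nk]; last first.
  rewrite big_nil big1 // => i _; rewrite /bump /= leqNgt mulSn.
  by rewrite (leq_trans (_ : n < k.+1)%N) // leq_addr.
rewrite big_map (IHM _ (fun l => Phi (k.+1 :: l))).
- rewrite big_mkcond; apply: eq_bigr => i _; rewrite /bump /= mulSn.
  by rewrite leq_subRL // subnDA.
- by rewrite leq_subLR (leq_trans le_n) ?leq_addl.
by rewrite ltn_subLR // addSn ltnS (leq_trans lt_nM) ?leq_addl.
Qed.

(** A partition picks from the factor of each [j] the term indexed by its multiplicity. Truncation
    at [M] loses nothing in degree [n < M]. *)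
Lemma sum_parts_le (M fuel n k : nat) (f : nat -> nat -> R) :
    (n <= fuel)%N -> (n < M)%N ->
  \sum_(la <- parts_le fuel n k) \prod_(j <- iota 1 k) f j (count_mem j la) =
    (\prod_(j <- iota 1 k) \sum_(m < M) f j m *: 'X^(m * j))`_n.
Proof.
elim: k n => [|k IHk] n le_n lt_nM.
  rewrite big_nil coef1; case: fuel le_n => [|fuel] le_n /=; case: eqP => _;
    by rewrite ?big_seq1 ?big_nil ?minn0 ?big_nil.
rewrite (@sum_parts_leS M) // iota1S big_cat /= big_seq1.
rewrite mulrC mulr_suml coef_sum big_mkcond; apply: eq_bigr => m _ /=.
rewrite -scalerAl coefZ coefXnM ltnNge; case: leqP => _ /=; last by rewrite mulr0.
rewrite -IHk; last 2 first.
- by rewrite (leq_trans (leq_subr _ _)).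
- by rewrite (leq_ltn_trans (leq_subr _ _)).
rewrite mulr_sumr big_seq [RHS]big_seq; apply: eq_bigr => la /mem_parts_le[_ in_la].
rewrite big_cat /= big_seq1 mulrC; congr (f _ _ * _).
  rewrite count_cat count_nseq /= eqxx mul1n -[RHS]addn0; congr (_ + _)%N.
  by apply/count_memPn/negP => /in_la; rewrite ltnn andbF.
rewrite big_seq [RHS]big_seq; apply: eq_bigr => j.
rewrite mem_iota add1n => /andP[_ lt_jk].
by rewrite count_cat count_nseq /= gtn_eqF.
Qed.

Lemma sum_partitions (N n : nat) (f : nat -> nat -> R) : (n <= N)%N ->
  \sum_(la <- partitions n) \prod_(j <- iota 1 N) f j (count_mem j la) =
    (\prod_(j <- iota 1 N) \sum_(m < N.+1) f j m *: 'X^(m * j))`_n.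
Proof.
move=> le_nN; rewrite -(@sum_parts_le N.+1 n n) //.
by rewrite /partitions (@parts_le_stable _ _ _ N).
Qed.

End PartitionSeries.

(** * Truncated logarithmic derivatives *)

Section LogDerivative.
Variable F : numFieldType.
Implicit Types (P Q A B D : {poly F}) (N : nat).

(** This is congruence to 0 modulo ['X^(N.+1)], so that polynomials can stand in for power
    series. *)
Definition vanish_upto N D := forall i, (i <= N)%N -> D`_i = 0.

(* [P] is the logarithmic derivative ['X * A' / A] of [A], up to order [N]. *)
Definition logder_upto N P A := vanish_upto N ('X * A^`() - P * A).

Lemma vanish_upto0 N : vanish_upto N 0.
Proof. by move=> i _; rewrite coef0. Qed.

Lemma vanish_uptoD N D E :
  vanish_upto N D -> vanish_upto N E -> vanish_upto N (D + E).
Proof. by move=> D0 E0 i le_iN; rewrite coefD D0 ?E0 ?addr0. Qed.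

Lemma vanish_uptoMr N D E : vanish_upto N D -> vanish_upto N (D * E).
Proof.
move=> D0 i le_iN; rewrite coefM big1 // => j _.
by rewrite D0 ?mul0r // (leq_trans _ le_iN) // -ltnS.
Qed.

Lemma coefX_deriv A i : ('X * A^`())`_i = i%:R * A`_i.
Proof.
by rewrite coefXM; case: i => [|i] /=; rewrite ?mul0r // coef_deriv mulr_natl.
Qed.

Lemma logder1 N : logder_upto N 0 1.
Proof. by rewrite /logder_upto derivC mulr0 mul0r subrr; apply: vanish_upto0. Qed.

Lemma logderM N P Q A B :
  logder_upto N P A -> logder_upto N Q B -> logder_upto N (P + Q) (A * B).
Proof.
move=> PA QB; rewrite /logder_upto.
suff -> : 'X * (A * B)^`() - (P + Q) * (A * B) =
    ('X * A^`() - P * A) * B + ('X * B^`() - Q * B) * A.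
  by apply: vanish_uptoD; apply: vanish_uptoMr.
by rewrite derivM; ring.
Qed.

Lemma logder_prod (T : Type) N (s : seq T) (P A : T -> {poly F}) :
  (forall t, logder_upto N (P t) (A t)) ->
  logder_upto N (\sum_(t <- s) P t) (\prod_(t <- s) A t).
Proof.
move=> PA; elim: s => [|t s IHs]; first by rewrite !big_nil; apply: logder1.
by rewrite !big_cons; apply: logderM.
Qed.

Lemma logder_eq N P Q A B :
    vanish_upto N (P - Q) -> vanish_upto N (A - B) ->
  logder_upto N P A -> logder_upto N Q B.
Proof.
move=> PQ AB PA; rewrite /logder_upto.
have eq_coef (D E : {poly F}) : vanish_upto N (D - E) ->
    forall i, (i <= N)%N -> D`_i = E`_i.
  by move=> DE i /DE/eqP; rewrite coefB subr_eq0 => /eqP.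
move=> i le_iN; rewrite -[RHS](PA i le_iN) !coefB !coefX_deriv.
rewrite (eq_coef _ _ AB) //; congr (_ - _); rewrite !coefM.
apply: eq_bigr => j _; rewrite (eq_coef _ _ PQ) ?(eq_coef _ _ AB) //.
  by rewrite (leq_trans (leq_subr _ _)).
by rewrite (leq_trans _ le_iN) // -ltnS.
Qed.

(** The coefficient of degree [i] in ['X * A' = P * A] expresses [i * A_i] through
    [A_0, ..., A_(i-1)], because [P] has no constant term. Dividing by [i] determines [A] from
    [A_0]. *)
Lemma logder_inj N P A B :
    P`_0 = 0 -> A`_0 = B`_0 -> logder_upto N P A -> logder_upto N P B ->
  forall i, (i <= N)%N -> A`_i = B`_i.
Proof.
move=> P0 AB0 PA PB; elim/ltn_ind => -[//|i] IHi le_iN.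
have := PA _ le_iN; have := PB _ le_iN.
rewrite !coefB !coefX_deriv !coefM => /eqP; rewrite subr_eq0 => /eqP eqB.
move=> /eqP; rewrite subr_eq0 => /eqP eqA.
have nz_i : i.+1%:R != 0 :> F by rewrite pnatr_eq0.
apply: (mulfI nz_i); rewrite eqA eqB; apply: eq_bigr => -[[|j] ltj] _ /=.
  by rewrite P0 !mul0r.
by rewrite IHi ?subSS ?ltnS ?leq_subr // (leq_trans (leq_subr _ _)) // ltnW.
Qed.

(** By the chain rule, the operator ['X * d/d'X] commutes with the substitution of ['X^j] up to the
    factor [j]. *)
Lemma logder_comp N j P A : (0 < j)%N ->
  logder_upto N P A -> logder_upto N (j%:R *: (P \Po 'X^j)) (A \Po 'X^j).
Proof.
move=> j0 PA; rewrite /logder_upto.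
have -> : 'X * (A \Po 'X^j)^`() - j%:R *: (P \Po 'X^j) * (A \Po 'X^j) =
    j%:R *: (('X * A^`() - P * A) \Po 'X^j).
  rewrite deriv_comp derivXn comp_polyB !comp_polyM comp_polyX scalerBr.
  rewrite -scalerAl; congr (_ - _).
  case: j j0 => // j _; rewrite mulrCA mulrnAr mulrnAr -exprS mulrC.
  by rewrite scaler_nat.
move=> i le_iN; rewrite coefZ coef_comp_poly_Xn //; case: ifP => _; last by rewrite mulr0.
by rewrite PA ?mulr0 // (leq_trans (leq_div _ _)).
Qed.

(** The sum is a truncation of exp(a X^k / k), whose logarithmic derivative is a X^k. *)
Lemma logder_expX N k (a : F) : (0 < k)%N ->
  logder_upto N (a *: 'X^k)
    (\sum_(m < N.+1) (a ^+ m / (k ^ m * m`!)%:R) *: 'X^(m * k)).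
Proof.
rewrite /logder_upto => k0; have nz_k : k%:R != 0 :> F by rewrite pnatr_eq0 -lt0n.
pose t m : {poly F} := (a ^+ m / (k ^ m * m`!)%:R * (m * k)%:R) *: 'X^(m * k).
have -> : 'X * (\sum_(m < N.+1) (a ^+ m / (k ^ m * m`!)%:R) *: 'X^(m * k))^`() =
    \sum_(m < N.+1) t m.
  rewrite raddf_sum mulr_sumr; apply: eq_bigr => m _; apply/polyP => i.
  rewrite coefX_deriv !coefZ coefXn; case: eqP => [->|_]; rewrite ?mulr0 //.
  by rewrite !mulr1 mulrC.
have -> : a *: 'X^k * (\sum_(m < N.+1) (a ^+ m / (k ^ m * m`!)%:R) *: 'X^(m * k)) =
    \sum_(m < N.+1) t m.+1.
  rewrite mulr_sumr; apply: eq_bigr => m _.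
  rewrite -scalerAl -scalerAr scalerA -exprD -mulSn; congr (_ *: _).
  have nz_m : m.+1%:R != 0 :> F by rewrite pnatr_eq0.
  have nz_km : (k ^ m)%:R != 0 :> F by rewrite pnatr_eq0 -lt0n expn_gt0 k0.
  have nz_mf : (m`!)%:R != 0 :> F by rewrite pnatr_eq0 -lt0n fact_gt0.
  rewrite exprS expnS factS !natrM.
  move: (m.+1%:R) nz_m (k%:R) nz_k ((k ^ m)%:R) nz_km ((m`!)%:R) nz_mf (a ^+ m).
  by move=> M nz_M K nz_K L nz_L E nz_E b; field; rewrite nz_M nz_K nz_L nz_E.
rewrite -sumrB => i le_iN; rewrite coef_sum.
(* The difference telescopes: [t 0] is zero, and [t N.+1] has degree [N.+1 * k], beyond the
   truncation order. *)
suff -> : \sum_(m < N.+1) (t m - t m.+1)`_i = (t 0%N - t N.+1)`_i.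
  rewrite !coefB !coefZ mul0n mulr0 mul0r coefXn ltn_eqF ?mulr0 ?subrr //.
  exact: leq_ltn_trans le_iN (leq_pmulr _ k0).
rewrite -coef_sum; congr ((_ : {poly F})`_i).
elim: (N.+1) => [|M IHM]; first by rewrite big_ord0 subrr.
by rewrite big_ord_recr IHM /= addrA subrK.
Qed.

End LogDerivative.

(** * Complete functions from power sums *)

Lemma mem_partitions n la :
  la \in partitions n -> sumn la = n /\ {in la, forall i, 0 < i <= n}%N.
Proof. exact: mem_parts_le. Qed.

Lemma rank_cons (i : nat) (la : seq nat) : (0 < i)%N -> {in la, forall j, 0 < j}%N ->
  Defs.rank (i :: la) = (i.-1 + Defs.rank la)%N.
Proof.
move=> i0 la0; rewrite /Defs.rank /=.
(* Positive parts make the truncated subtraction in [rank] exact. *)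
suff : (size la <= sumn la)%N by case: i i0 => // i _ /addnBA->; rewrite subSS.
elim: la la0 {i i0} => //= i la IHla la0; rewrite -add1n leq_add ?la0 ?mem_head //.
by apply: IHla => j laj; rewrite la0 // in_cons laj orbT.
Qed.

Lemma rank_prod (R : pzRingType) (la : seq nat) : {in la, forall j, 0 < j}%N ->
  (-1) ^+ Defs.rank la = \prod_(j <- la) (-1) ^+ j.-1 :> R.
Proof.
elim: la => [|i la IHla] la0; first by rewrite big_nil expr0.
have la'0 : {in la, forall j, 0 < j}%N by move=> j laj; rewrite la0 // in_cons laj orbT.
by rewrite rank_cons ?la0 ?mem_head // exprD IHla // big_cons.
Qed.

(** This turns products over the distinct parts, as in [zee], into products over a fixed range;
    absent values contribute the neutral element. *)
Lemma prod_undup_count (R : Type) (idx : R) (op : Monoid.com_law idx)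
    (N : nat) (s : seq nat) (w : nat -> nat -> R) :
    {in s, forall i, 0 < i <= N}%N -> (forall i, w i 0%N = idx) ->
  \big[op/idx]_(i <- undup s) w i (count_mem i s) =
    \big[op/idx]_(i <- iota 1 N) w i (count_mem i s).
Proof.
move=> in_s w0; rewrite [RHS](bigID (mem s)) /= [X in op _ X]big1 ?Monoid.mulm1; last first.
  by move=> i /count_memPn->.
rewrite -[RHS]big_filter; apply: perm_big; apply: uniq_perm.
- exact: undup_uniq.
- by rewrite filter_uniq ?iota_uniq.
move=> i; rewrite mem_undup mem_filter mem_iota add1n ltnS /=.
by case: (boolP (i \in s)) => // /in_s->.
Qed.

Lemma prod_exp_count (R : comNzRingType) (N : nat) (s : seq nat) (r : nat -> R) :
    {in s, forall i, 0 < i <= N}%N ->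
  \prod_(i <- s) r i = \prod_(i <- iota 1 N) r i ^+ count_mem i s.
Proof.
move=> in_s; rewrite -(@prod_undup_count _ _ _ N s (fun i c => r i ^+ c)) //.
by rewrite prodr_undup_exp_count.
Qed.

Section CompleteFromPowerSums.
Variable F : numFieldType.
Implicit Types r s : nat -> F.

(* [h_m] as a function of the values [r k] of the power sums [p_k]. *)
Definition h_of_p r m : F :=
  \sum_(rho <- partitions m) (zee rho)%:R^-1 * \prod_(k <- rho) r k.

Definition p_series N r : {poly F} := \sum_(k <- iota 1 N) r k *: 'X^k.

Definition h_series N r : {poly F} := \poly_(m < N.+1) h_of_p r m.

(** Both [zee rho] and the product of the [r k] factor over the part sizes, so [sum_partitions]
    applies and each [k] gives a truncated exponential. *)
Lemma h_of_p_coef N r m : (m <= N)%N -> h_of_p r m =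
  (\prod_(k <- iota 1 N)
     \sum_(c < N.+1) (r k ^+ c / (k ^ c * c`!)%:R) *: 'X^(c * k))`_m.
Proof.
move=> le_mN; rewrite -(@sum_partitions _ N m (fun k c => r k ^+ c / (k ^ c * c`!)%:R)) //.
rewrite /h_of_p big_seq [RHS]big_seq; apply: eq_bigr => rho /mem_partitions[_ in_rho].
have {}in_rho : {in rho, forall i, 0 < i <= N}%N.
  by move=> i /in_rho/andP[-> /leq_trans->].
rewrite /zee (@prod_undup_count _ _ _ N rho (fun i c => i ^ c * c`!)%N) //.
by rewrite (prod_exp_count _ in_rho) natr_prod -prodfV -big_split; apply: eq_bigr => k _ /=; rewrite mulrC.
Qed.

(** Newton's identities: the series of the h_m is the product over k of exp(p_k X^k / k). *)
Lemma logder_h_series N r : logder_upto N (p_series N r) (h_series N r).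
Proof.
pose A := \prod_(k <- iota 1 N)
     \sum_(c < N.+1) (r k ^+ c / (k ^ c * c`!)%:R) *: 'X^(c * k).
have : logder_upto N (p_series N r) A.
  rewrite /p_series /A big_seq [X in logder_upto _ _ X]big_seq.
  rewrite big_mkcond [X in logder_upto _ _ X]big_mkcond.
  apply: logder_prod => k; case: ifP; last by move=> _; apply: logder1.
  by rewrite mem_iota => /andP[k0 _]; apply: logder_expX.
apply: logder_eq; first by rewrite subrr; apply: vanish_upto0.
move=> i le_iN; rewrite coefB coef_poly ltnS le_iN.
by rewrite (@h_of_p_coef N) ?subrr.
Qed.

Lemma h_of_p0 r : h_of_p r 0 = 1.
Proof. by rewrite /h_of_p big_seq1 /zee !big_nil invr1 mulr1. Qed.

Lemma eq_h_of_p r s m : (forall k, (0 < k)%N -> r k = s k) -> h_of_p r m = h_of_p s m.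
Proof.
move=> eq_rs; rewrite /h_of_p big_seq [RHS]big_seq.
apply: eq_bigr => rho /mem_partitions[_ in_rho]; congr (_ * _).
by rewrite big_seq [RHS]big_seq; apply: eq_bigr => k /in_rho/andP[/eq_rs].
Qed.

(** Homogeneity: h_m has degree m when p_k is given degree k. *)
Lemma h_of_p_scale a r m : h_of_p (fun k => a ^+ k * r k) m = a ^+ m * h_of_p r m.
Proof.
rewrite /h_of_p mulr_sumr big_seq [RHS]big_seq.
apply: eq_bigr => rho /mem_partitions[<- _]; rewrite mulrCA; congr (_ * _).
by rewrite big_split prodrXr sumnE.
Qed.

Lemma h_of_p1 r : h_of_p r 1 = r 1%N.
Proof.
rewrite (@h_of_p_coef 1%N) // big_seq1 big_ord_recl big_ord1 coefD !coefZ !coefXn.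
by rewrite mulr0 add0r mulr1 divr1.
Qed.

End CompleteFromPowerSums.

Lemma sf_eval_h_pleth x m f :
  sf_eval x (h_pleth m f) = h_of_p (fun k => sf_eval (fun i => x (k * i)%N) f) m.
Proof.
rewrite sf_eval_sum; apply: eq_bigr => rho _; rewrite sf_eval_scale sf_eval_prod.
by congr (_ * _); apply: eq_bigr => k _; rewrite sf_eval_p_pleth.
Qed.

(** The sign of [rho] splits as a product of (-1)^(k-1) over its parts, and these signs are absorbed
    into the power sums. *)
Lemma sf_eval_e_pleth x m f : sf_eval x (e_pleth m f) =
  h_of_p (fun k => (-1) ^+ k.-1 * sf_eval (fun i => x (k * i)%N) f) m.
Proof.
rewrite sf_eval_sum /h_of_p big_seq [RHS]big_seq.
apply: eq_bigr => rho /mem_partitions[_ in_rho]; rewrite sf_eval_scale sf_eval_prod.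
rewrite big_split -rank_prod; last by move=> k /in_rho/andP[].
rewrite -mulrA mulrCA; congr (_ * (_ * _)).
by apply: eq_bigr => k _; rewrite sf_eval_p_pleth.
Qed.

Lemma sf_eval_h x m : sf_eval x (sf_h m) = h_of_p x m.
Proof.
rewrite sf_eval_h_pleth; apply: eq_h_of_p => k _.
by rewrite /sf_eval !big_seq1 mul1r muln1.
Qed.

(* For even [j] the sign turns [e_m] into [h_m] of the negated power sums, so
   that one formula covers both parities. *)
Lemma sf_eval_signed_pleth x j m f : (0 < j)%N ->
  (-1) ^+ (j.-1 * m) * sf_eval x ((if odd j then h_pleth else e_pleth) m f) =
    h_of_p (fun k => (-1) ^+ j.-1 * sf_eval (fun i => x (k * i)%N) f) m.
Proof.
case: j => // j _ /=; rewrite exprM -(signr_odd _ j).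
case: (odd j) => /=; rewrite ?expr1 ?expr0.
  rewrite sf_eval_e_pleth -h_of_p_scale; apply: eq_h_of_p => -[|k] // _ /=.
  by rewrite mulrA -exprD addSn exprS addnn -mul2n exprM sqrrN !expr1n mulr1.
rewrite expr1n mul1r sf_eval_h_pleth; apply: eq_h_of_p => k _.
by rewrite mul1r.
Qed.

(** * The hook Schur function *)

Lemma coef_h_series (F : numFieldType) N (r : nat -> F) m : (m <= N)%N ->
  (h_series N r)`_m = h_of_p r m.
Proof. by move=> le_mN; rewrite coef_poly ltnS le_mN. Qed.

Lemma p_seriesN (F : numFieldType) N (r : nat -> F) :
  p_series N (fun k => - r k) = - p_series N r.
Proof. by rewrite /p_series -sumrN; apply: eq_bigr => k _; rewrite scaleNr. Qed.

(** At negated power sums h_m becomes (-1)^m e_m, so this is H(t) E(-t) = 1. The two logarithmic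
    derivatives cancel, and the product has that of the constant 1. *)
Lemma h_of_p_conv (F : numFieldType) (r : nat -> F) m :
  \sum_(i < m.+1) h_of_p r i * h_of_p (fun k => - r k) (m - i) = (m == 0%N)%:R.
Proof.
have := logderM (@logder_h_series _ m r) (@logder_h_series _ m (fun k => - r k)).
rewrite p_seriesN subrr => ldHE; rewrite -coef1.
rewrite -(logder_inj (coef0 _ 0) _ ldHE (@logder1 _ m)) //.
  rewrite coefM; apply: eq_bigr => i _.
  by rewrite !coef_h_series ?leq_subr // -ltnS.
by rewrite coefM big_ord1 !coef_h_series // !h_of_p0 mulr1 coef1.
Qed.

(* Multiplying by the unitriangular matrix of the [b (l - j)] on the right
   leaves ones on the subdiagonal and clears the last column below row 0. *)
Lemma det_hook_jacobi_trudi (R : comNzRingType) (h b : nat -> R) k :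
    b 0%N = 1 ->
    (forall m, \sum_(i < m.+1) h i * b (m - i)%N = (m == 0%N)%:R) ->
  \det (\matrix_(i < k.+1, j < k.+1)
     (if (nth 0 (2 :: nseq k 1) i + j < i)%N then 0
      else h (nth 0 (2 :: nseq k 1) i + j - i)%N)) =
  (-1) ^+ k.+1 * (b k.+2 + h 1%N * b k.+1).
Proof.
move=> b0 conv; have h0 : h 0%N = 1.
  by have := conv 0%N; rewrite big_ord1 b0 mulr1.
set M := \matrix_(i, j) _.
pose U : 'M[R]_k.+1 := \matrix_(j, l) if (j <= l)%N then b (l - j)%N else 0.
have detU : \det U = 1.
  rewrite -det_tr det_trig; last first.
    by apply/is_trig_mxP => i j lt_ij; rewrite !mxE leqNgt lt_ij.
  by rewrite big1 // => i _; rewrite !mxE leqnn subnn.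
(* Row 0 of [M] starts at [h 2], so the product is the convolution at [l.+2], which vanishes,
   without its first two terms. *)
have MU0 l : (M *m U) ord0 l = - (b l.+2 + h 1%N * b l.+1).
  rewrite mxE; have := conv l.+2; rewrite 2!big_ord_recl /= h0 mul1r subn0 addrA.
  rewrite /bump /= subSS subn0 => /eqP; rewrite addrC addr_eq0 => /eqP <-.
  rewrite (big_ord_widen k.+1 (fun j => h (1 + (1 + j))%N * b (l.+2 - (1 + (1 + j)))%N)) //.
  rewrite [in RHS]big_mkcond; apply: eq_bigr => j _; rewrite !mxE /= subn0 ltnS.
  by case: ifP => _; rewrite ?mulr0 // !subSS.
(* Row [i.+1] of [M] is the sequence [h] shifted to start at column [i], so its product with column
   [l] is the full convolution at [l - i]. *)
have MUS (i : 'I_k) l : (M *m U) (lift ord0 i) l = (i == l :> nat)%:R.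
  have Mi j : M (lift ord0 i) j = if (j < i)%N then 0 else h (j - i)%N.
    by rewrite mxE /= /bump /= nth_nseq ltn_ord add1n ltnS subSS.
  rewrite mxE; have [le_il | lt_li] := leqP i l; last first.
    rewrite big1 => [|j _]; first by rewrite gtn_eqF.
    rewrite Mi mxE; case: ltnP => [_|le_ij]; first by rewrite mul0r.
    by rewrite leqNgt (leq_trans lt_li le_ij) mulr0.
  transitivity (\sum_(0 <= j < l.+1) (if (j < i)%N then 0 else h (j - i)%N) * b (l - j)%N).
    rewrite big_mkord (big_ord_widen k.+1
      (fun j => (if (j < i)%N then 0 else h (j - i)%N) * b (l - j)%N)) //.
    rewrite [in RHS]big_mkcond; apply: eq_bigr => j _; rewrite Mi mxE ltnS.
    by case: (j <= l)%N; rewrite ?mulr0.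
  rewrite (@big_cat_nat _ _ _ i) ?(leq_trans le_il) //= big_nat big1 ?add0r; last first.
    by move=> j /andP[_ lt_ji]; rewrite lt_ji mul0r.
  rewrite -{1}[val i]add0n big_addn subSn // big_mkord.
  rewrite eqn_leq le_il /= -subn_eq0 -conv; apply: eq_bigr => j _.
  by rewrite ltnNge leq_addl /= addnK addnC subnDA.
have <- : \det (M *m U) = \det M by rewrite det_mulmx detU mulr1.
rewrite (expand_det_col _ ord_max) big_ord_recl.
rewrite [X in _ + X]big1 ?addr0 => [|i _]; last by rewrite MUS ltn_eqF ?mul0r.
rewrite MU0 /cofactor add0n /=.
have -> : row' ord0 (col' ord_max (M *m U)) = 1%:M.
  by apply/matrixP => i l; rewrite 2!mxE [RHS]mxE MUS lift_max.
by rewrite det1 mulr1 exprS mulN1r !mulNr mulrC.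
Qed.

(** The length enters through an equation so that the matrix dimension can be the successor [k.+1]
    for the hook. *)
Lemma sf_eval_schur x (mu : seq nat) k : size mu = k ->
  sf_eval x (schur mu) = \det (\matrix_(i < k, j < k)
     (if (nth 0 mu i + j < i)%N then 0 else h_of_p x (nth 0 mu i + j - i)%N)).
Proof.
move=> <-; rewrite /schur sf_eval_sum big_enum; apply: eq_bigr => s _.
rewrite sf_eval_scale sf_eval_prod big_enum; congr (_ * _).
apply: eq_bigr => i _; rewrite mxE /sf_h_diff; case: ifP => _.
  by rewrite /sf_eval big_nil.
exact: sf_eval_h.
Qed.

Lemma sf_eval_schur_hook x n : (2 <= n)%N ->
  (-1) ^+ (n - 1) * sf_eval x (schur (2%N :: nseq (n - 2) 1%N)) =
    h_of_p (fun k => - x k) n + x 1%N * h_of_p (fun k => - x k) n.-1.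
Proof.
case: n => [|[|k]] // _; rewrite !subSS !subn0.
rewrite (@sf_eval_schur _ _ k.+1) /= ?size_nseq //.
rewrite (@det_hook_jacobi_trudi _ (h_of_p x) (h_of_p (fun k => - x k))).
- by rewrite mulrA -expr2 sqrr_sign mul1r h_of_p1.
- exact: h_of_p0.
exact: h_of_p_conv.
Qed.

(** * Characters induced from a full cycle *)

Section CyclicCycleTypes.
Variable n : nat.
Implicit Types (s g c : 'S_n).

(** The map [g] carries the orbits of [s] bijectively, with their sizes, onto those of the
    conjugate. *)
Lemma cycletypeJ s g : cycletype (s ^ g)%g = cycletype s.
Proof.
have geq_total : total geq by move=> i j; apply: leq_total.
have geq_trans : transitive geq by move=> j i k /= le_ji le_kj; apply: leq_trans le_ji.
have geq_anti : antisymmetric geq by move=> i j /= /andP[? ?]; apply/eqP; rewrite eqn_leq; apply/andP.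
apply/perm_sortP => //; pose h (X : {set 'I_n}) := g @: X.
have h_inj : injective h by apply: imset_inj; apply: perm_inj.
have porbitJ x : porbit (s ^ g)%g (g x) = h (porbit s x).
  apply/setP => y; apply/porbitP/imsetP => [[i ->] | [_ /porbitP[i ->] ->]].
    exists ((s ^+ i)%g x); first exact: mem_porbit.
    by rewrite -conjXg !permM permK.
  by exists i; rewrite -conjXg !permM permK.
have -> : [seq #|X| | X : {set 'I_n} <- enum (porbits s)] =
          [seq #|X| | X : {set 'I_n} <- [seq h X | X <- enum (porbits s)]].
  by rewrite -map_comp; apply: eq_map => X /=; rewrite card_imset //; apply: perm_inj.
apply: perm_map; apply: uniq_perm; rewrite ?enum_uniq //.
  by rewrite map_inj_uniq ?enum_uniq.
move=> X; rewrite mem_enum; apply/imsetP/mapP => [[y _ ->] | [Y]].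
  exists (porbit s (g^-1 y)%g); first by rewrite mem_enum imset_f.
  by rewrite -porbitJ permKV.
by rewrite mem_enum => /imsetP[y _ ->] ->; exists (g y).
Qed.

Variable c : 'S_n.
Hypotheses (n_gt0 : (0 < n)%N) (c_cycle : #|porbits c| = 1%N).

(** Powers of [s] commute with the transitive [c], so two of them that agree at [x] agree
    everywhere. *)
Lemma card_porbit_cycle s x : s \in <[c]>%g -> #|porbit s x| = #[s]%g.
Proof.
move=> cs; rewrite porbit.unlock card_in_imset // => u v su sv eq_uv.
have in_porbits z : porbit c z \in porbits c by apply: imset_f.
have trans y : exists i, y = (c ^+ i)%g x.
  apply/porbitP; have /eqP/cards1P[X eqX] := c_cycle.
  have := in_porbits x; have := in_porbits y.
  by rewrite eqX !inE => /eqP<- /eqP->; apply: porbit_id.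
have comm w i : w \in <[s]>%g -> (w * c ^+ i = c ^+ i * w)%g.
  move=> sw; apply: commuteX; have : w \in <[c]>%g by move: w sw; apply/subsetP; rewrite cycle_subG.
  by case/cycleP => k ->; apply/commute_sym/commuteX.
apply/permP => y; have [i ->] := trans y.
by rewrite -!permM -!comm // !permM; congr ((c ^+ i)%g _).
Qed.

Lemma cycletype_cycle s : s \in <[c]>%g ->
  cycletype s = nseq (n %/ #[s]%g) #[s]%g.
Proof.
move=> cs; set d := #[s]%g.
have card_d (X : {set 'I_n}) : X \in porbits s -> #|X| = d.
  by case/imsetP => x _ ->; apply: card_porbit_cycle.
have part : partition (porbits s) setT.
  have -> : porbits s = orbit 'P <[s]>%g @: setT.
    by rewrite -porbitE; apply/setP => X; apply/imsetP/imsetP => -[y _ ->]; exists y.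
  by apply: orbit_partition; apply/actsP => a _ y; rewrite !inE.
have card_porbits : #|porbits s| = (n %/ d)%N.
  have := card_uniform_partition card_d part.
  by rewrite cardsT card_ord => card_n; rewrite [X in (X %/ d)%N]card_n mulnK ?order_gt0.
have -> : (n %/ d)%N = size (cycletype s) by rewrite size_sort size_map -cardE.
apply/all_pred1P; rewrite all_sort all_map; apply/allP => X.
by rewrite mem_enum => /card_d /= ->.
Qed.

Lemma order_cycle : #[c]%g = n.
Proof.
pose x := Ordinal n_gt0; rewrite -(card_porbit_cycle x (cycle_id c)).
have /eqP/cards1P[X eqX] := c_cycle; rewrite -[RHS]card_ord -cardsT; congr #|pred_of_set _|.
apply/setP => y; rewrite inE -eq_porbit_mem.
have in_porbits z : porbit c z \in porbits c by apply: imset_f.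
by have := in_porbits x; have := in_porbits y; rewrite eqX !inE => /eqP-> /eqP->; rewrite eqxx.
Qed.

Lemma big_cycle (R : nmodType) (G : 'S_n -> R) :
  \sum_(s in <[c]>%g) G s = \sum_(i < n) G (c ^+ i)%g.
Proof.
rewrite (reindex_onto (fun i : 'I_n => (c ^+ i)%g)
  (* The default index is never reached on [<[c]>], where every element is a power [c ^+ i] with
     [i < n]. *)
  (fun s => odflt (Ordinal n_gt0) [pick i : 'I_n | s == (c ^+ i)%g])) /=.
  apply: eq_bigl => i; rewrite mem_cycle /=; case: pickP => [j | /(_ i)]; last by rewrite eqxx.
  by rewrite eq_expg_ord ?order_cycle // eq_sym => /eqP->; rewrite eqxx.
move=> s /cyclePmin[i]; rewrite order_cycle => lt_in ->.
by case: pickP => [j /eqP-> // | /(_ (Ordinal lt_in))/=]; rewrite eqxx.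
Qed.

Variable phi : 'CF(<[c]>).

(** Frobenius reciprocity against the class function [W]: each of the n! conjugating elements
    contributes the same sum, supported on [<[c]>]. *)
Lemma sum_cfInd (W : 'S_n -> algC) : (forall s g, W (s ^ g)%g = W s) ->
  \sum_s 'Ind[[set: 'S_n]] phi s * W s = (n`!)%:R / n%:R * \sum_(i < n) phi (c ^+ i)%g * W (c ^+ i)%g.
Proof.
move=> WJ; transitivity (n%:R^-1 * \sum_s \sum_g phi (s ^ g)%g * W (s ^ g)%g).
  rewrite mulr_sumr; apply: eq_bigr => s _; rewrite cfIndE ?subsetT //.
  rewrite -mulrA -[#|_|]/(#[c]%g) order_cycle; congr (_ * _); rewrite mulr_suml.
  by apply: eq_big => [g | g _]; rewrite ?inE // WJ.
rewrite exchange_big /= -mulrA mulrCA; congr (_ * _).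
transitivity (\sum_(g : 'S_n) \sum_s phi s * W s).
  by apply: eq_bigr => g _; rewrite [RHS](reindex_inj (conjg_inj g)).
rewrite sumr_const; have -> : #|{: 'S_n}| = n`! by rewrite -card_Sn.
rewrite -[LHS]mulr_natl; congr (_ * _); rewrite -(big_cycle (fun s => phi s * W s)).
rewrite [RHS]big_mkcond; apply: eq_bigr => s _; case: ifPn => // c's.
by rewrite cfun0 ?mul0r.
Qed.

(** The power [c ^+ i] consists of gcd(n, i) cycles of equal length n / gcd(n, i), hence has rank n
    - gcd(n, i). *)
Lemma sf_eval_omega_frob_cycle x :
  sf_eval x (sf_omega (frob ('Ind[[set: 'S_n]] phi))) =
  n%:R^-1 * \sum_(i < n) phi (c ^+ i)%g *
     ((-1) ^+ (n - gcdn n i) * x (n %/ gcdn n i)%N ^+ gcdn n i).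
Proof.
pose W s : algC := (-1) ^+ Defs.rank (cycletype s) * \prod_(k <- cycletype s) x k.
have regroup (r a f P : algC) : r * (a * f) * P = f * (a * (r * P)) by ring.
rewrite /sf_eval /sf_omega big_map big_map big_enum /=.
transitivity ((n`!)%:R^-1 * \sum_s 'Ind[[set: 'S_n]] phi s * W s).
  rewrite mulr_sumr; apply: eq_bigr => s _; rewrite /W.
  exact: regroup.
rewrite sum_cfInd; last by move=> s g; rewrite /W cycletypeJ.
rewrite -[X in _ * X]mulrA mulKf ?pnatr_eq0 -?lt0n ?fact_gt0 //.
congr (_ * _); apply: eq_bigr => i _; congr (_ * _).
have g0 : (0 < gcdn n i)%N by rewrite gcdn_gt0 n_gt0.
have gn : (gcdn n i * (n %/ gcdn n i) = n)%N by rewrite mulnC divnK ?dvdn_gcdl.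
rewrite /W cycletype_cycle ?mem_cycle // orderXgcd order_cycle.
have -> : (n %/ (n %/ gcdn n i) = gcdn n i)%N.
  by rewrite -{1}gn mulnK // divn_gt0 // dvdn_leq ?dvdn_gcdl.
rewrite /Defs.rank sumn_nseq size_nseq [X in (X - _)%N]mulnC gn.
by rewrite big_nseq -Monoid.iteropE.
Qed.

End CyclicCycleTypes.

(** * Ramanujan sums and divisor sums *)

Section RamanujanSums.
Variable R : idomainType.
Implicit Types (z w : R) (j l d e : nat).

(* For [z] a primitive [j]-th root of unity and [d %| j] this is the Moebius
   value mu(d): [order_sum_dvd] is the recursion that characterizes mu. *)
Definition order_sum z j d : R := \sum_(i < j | (j %/ gcdn j i)%N == d) z ^+ i.

(** The exponents [i] for which [z ^+ i] has order dividing [e] are the multiples of [j %/ e]. The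
    total is therefore the sum of all [e]-th roots of unity, which is zero unless [e] is 1. *)
Lemma order_sum_dvd z j e : j.-primitive_root z -> (e %| j)%N ->
  \sum_(d < e.+1 | (d %| e)%N) order_sum z j d = (e == 1%N)%:R.
Proof.
move=> prim_z e_dv_j; have j0 := prim_order_gt0 prim_z.
have e0 : (0 < e)%N by apply: dvdn_gt0 e_dv_j.
pose q := (j %/ e)%N; have def_j : j = (q * e)%N by rewrite divnK.
have q0 : (0 < q)%N by move: j0; rewrite def_j muln_gt0 => /andP[].
have dvdE (i : nat) : (j %/ gcdn j i %| e)%N = (q %| i)%N.
  have g0 : (0 < gcdn j i)%N by rewrite gcdn_gt0 j0.
  rewrite -(dvdn_pmul2r g0) divnK ?dvdn_gcdl // {1}def_j mulnC dvdn_pmul2l //.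
  by rewrite dvdn_gcd {1}def_j dvdn_mulr.
transitivity (\sum_(i < j | (q %| i)%N) z ^+ i).
  rewrite [RHS](partition_big (fun i : 'I_j => inord (j %/ gcdn j i)%N : 'I_e.+1)
      (fun d : 'I_e.+1 => (d %| e)%N)) /=; last first.
    by move=> i; rewrite -dvdE => dv_e; rewrite inordK // ltnS dvdn_leq.
  apply: eq_bigr => d d_dv_e; apply: eq_bigl => i; rewrite -val_eqE /= -dvdE.
  have [dv_e | ndv_e] /= := boolP (_ %| e)%N; first by rewrite inordK // ltnS dvdn_leq.
  by apply: contraNF ndv_e => /eqP->.
have lt_j (a : 'I_e) : (q * a < j)%N by rewrite [j in (_ < j)%N]def_j ltn_pmul2l.
have lt_e (i : 'I_j) : (i %/ q < e)%N by rewrite ltn_divLR // mulnC -def_j.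
rewrite (reindex_onto (fun a => Ordinal (lt_j a)) (fun i => Ordinal (lt_e i))) /=; last first.
  by move=> i q_dv_i; apply: val_inj; rewrite /= mulnC divnK.
transitivity (\sum_(a < e) (z ^+ q) ^+ a).
  apply: eq_big => [a | a _]; last by rewrite exprM.
  by rewrite dvdn_mulr //= -val_eqE /= mulKn // eqxx.
have prim_zq : e.-primitive_root (z ^+ q) by apply: dvdn_prim_root.
have [e1 | ne1] := eqVneq e 1%N.
  by rewrite e1 big_ord1 expr0.
have /eqP := subrX1 (z ^+ q) e; rewrite (prim_expr_order prim_zq) subrr eq_sym mulf_eq0.
case/orP => [|/eqP//]; rewrite subr_eq0 -[z ^+ q]expr1 -(prim_order_dvd prim_zq).
by rewrite dvdn1 (negbTE ne1).
Qed.

(** The recursion [order_sum_dvd] determines the value at [d] from those at proper divisors, with no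
    reference to the root. *)
Lemma order_sum_indep z w j l d : j.-primitive_root z -> l.-primitive_root w ->
  (d %| j)%N -> (d %| l)%N -> order_sum z j d = order_sum w l d.
Proof.
move=> prim_z prim_w; elim/ltn_ind: d => d IHd d_dv_j d_dv_l.
have split_last (G : nat -> R) : \sum_(i < d.+1 | (i %| d)%N) G i =
    \sum_(i < d | (i %| d)%N) G i + G d.
  by rewrite big_mkcond big_ord_recr /= dvdnn -big_mkcond.
have := order_sum_dvd prim_w d_dv_l; rewrite -(order_sum_dvd prim_z d_dv_j).
rewrite !split_last; under eq_bigr => i i_dv_d.
  rewrite -IHd //; last 2 first.
  - by rewrite (dvdn_trans i_dv_d).
  - by rewrite (dvdn_trans i_dv_d).
  over.
by move/addrI.
Qed.

End RamanujanSums.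

Section DivisorSums.
Variables (V : nmodType) (N : nat).

Lemma big_cofactor (d j : nat) (G : nat -> V) : (0 < d)%N -> (j <= N)%N ->
  \sum_(m < N.+1 | (d * m)%N == j) G m = if (d %| j)%N then G (j %/ d)%N else 0.
Proof.
move=> d0 le_jN; case: ifPn => [/dvdnP[m def_j] | ndvd]; last first.
  by rewrite big_pred0 // => m; apply: contraNF ndvd => /eqP<-; apply: dvdn_mulr.
have lt_mN : (m < N.+1)%N by rewrite ltnS (leq_trans _ le_jN) // def_j leq_pmulr.
rewrite (big_pred1 (Ordinal lt_mN)) /=; first by rewrite def_j mulnK.
by move=> i; rewrite /= -val_eqE /= def_j mulnC eqn_pmul2r.
Qed.

(** Both sides run over the triples (d, m, k) with d m k = M: the left groups them by j = d m, the
    right by m. *)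
Lemma big_divisor_assoc (M : nat) (G : nat -> nat -> nat -> V) : (0 < M <= N)%N ->
  \sum_(j < N.+1 | (j %| M)%N) \sum_(d < N.+1 | (d %| j)%N) G d (j %/ d)%N (M %/ j)%N =
  \sum_(m < N.+1 | (m %| M)%N) \sum_(d < N.+1 | (d %| M %/ m)%N) G d m (M %/ m %/ d)%N.
Proof.
case/andP => M0 le_MN.
rewrite (exchange_big_dep predT) //= [RHS](exchange_big_dep predT) //=.
apply: eq_bigr => -[[|d] lt_d] _ /=.
  rewrite !big1 // => i /andP[i_dv_M]; rewrite dvd0n => /eqP i0.
    by move: M0; rewrite -(divnK i_dv_M) i0.
  by move: M0; rewrite -(divnK i_dv_M) i0 muln0.
transitivity (\sum_(j < N.+1 | (j %| M)%N) \sum_(m < N.+1 | (d.+1 * m)%N == j)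
    G d.+1 m (M %/ j)%N).
  rewrite big_mkcondr; apply: eq_bigr => j _.
  by rewrite (@big_cofactor d.+1 j (fun m => G d.+1 m (M %/ j)%N)) // -ltnS.
rewrite (exchange_big_dep predT) //= [RHS]big_mkcond; apply: eq_bigr => m _ /=.
have -> : (m %| M)%N && (d.+1 %| M %/ m)%N = (d.+1 * m %| M)%N.
  apply/andP/idP => [[m_dv] | dm_dv]; first by rewrite dvdn_divRL.
  have m_dv : (m %| M)%N by apply: dvdn_trans dm_dv; apply: dvdn_mull.
  by rewrite m_dv dvdn_divRL.
case: ifPn => [dm_dv | ndv]; last first.
  by rewrite big_pred0 // => j; apply: contraNF ndv => /andP[j_dv /eqP->].
have lt_dm : (d.+1 * m < N.+1)%N by rewrite ltnS (leq_trans _ le_MN) // dvdn_leq.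
rewrite (big_pred1 (Ordinal lt_dm)) /=; first by rewrite mulnC divnMA.
move=> j; rewrite /= -val_eqE /= eq_sym; case: eqP => [-> | _]; first by rewrite dm_dv.
by rewrite andbF.
Qed.

End DivisorSums.

(** * The alternating sum *)

Lemma coef_p_series (F : numFieldType) N (r : nat -> F) i :
  (p_series N r)`_i = if (0 < i <= N)%N then r i else 0.
Proof.
rewrite /p_series coef_sum; case: ifP => [rg_i | nrg_i].
  rewrite (bigD1_seq i) ?mem_iota ?add1n ?ltnS ?iota_uniq //= coefZ coefXn eqxx mulr1.
  by rewrite big1 ?addr0 // => k ne_ki; rewrite coefZ coefXn eq_sym (negbTE ne_ki) mulr0.
rewrite big_seq big1 // => k; rewrite mem_iota add1n ltnS => rg_k.
by rewrite coefZ coefXn; case: eqP nrg_i => [->|]; rewrite ?rg_k // mulr0.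
Qed.

Lemma h_series_comp (F : numFieldType) N (r : nat -> F) j :
  h_series N r \Po 'X^j = \sum_(m < N.+1) h_of_p r m *: 'X^(m * j).
Proof.
rewrite /h_series poly_def linear_sum; apply: eq_bigr => m _ /=.
by rewrite comp_polyZ comp_Xn_poly -exprM mulnC.
Qed.

(** This is the geometric series of aX / (1 + aX); from degree 2 on, consecutive terms cancel. *)
Lemma logder_linear (F : numFieldType) N (a : F) :
  logder_upto N (p_series N (fun k => (-1) ^+ k.-1 * a ^+ k)) (1 + a *: 'X).
Proof.
move=> i le_iN; rewrite coefB coefX_deriv mulrDr mulr1 -scalerAr !coefD !coefZ.
rewrite coefMX coef1 coefX !coef_p_series.
case: i le_iN => [|[|i]] le_iN /=; rewrite ?mul0r ?mulr0 ?addr0 ?subrr //.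
  by rewrite le_iN expr0 expr1 !mul1r !add0r !mulr1 subrr.
by rewrite le_iN (ltnW le_iN) !exprS; ring.
Qed.

Lemma big_iota1 (R : Type) (idx : R) (op : Monoid.law idx) N (G : nat -> R) :
  \big[op/idx]_(j <- iota 1 N) G j = \big[op/idx]_(j < N.+1 | (0 < j)%N) G j.
Proof.
rewrite -(big_mkord (fun j => 0 < j)%N) /index_iota subn0 big_cons /=.
rewrite big_seq [RHS]big_mkcond big_seq -big_mkcondr /=.
by apply: eq_bigl => j; rewrite mem_iota; case: (0 < j)%N; rewrite ?andbT ?andbF.
Qed.

(** This merges the rank sign of a part [m] with the sign that omega gives to [g] cycles in S_m. *)
Lemma signr_pred_addB (R : pzRingType) g m : (0 < g)%N -> (g <= m)%N ->
  (-1) ^+ (m.-1 + (m - g)) = (-1) ^+ g.-1 :> R.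
Proof.
case: g m => [|g] [|m] // _ le_gm; rewrite -[LHS]signr_odd -[RHS]signr_odd.
by rewrite subSS oddD oddB // addbA addbb.
Qed.

Section LiePowerSums.
Variables (c : forall j, 'S_j) (chi : forall j, 'CF(<[c j]>)).
Hypothesis hc : forall j, (0 < j)%N -> #|porbits (c j)| = 1%N.
Hypothesis hlin : forall j, chi j \is a linear_char.
Hypothesis hzeta : forall j, (0 < j)%N -> j.-primitive_root (chi j (c j)).
Variable x : nat -> algC.

(* [(-1)^(j-1) p_k[pi_j]], evaluated at [p_i = x i]. *)
Definition signed_lie_psum j k : algC :=
  (-1) ^+ j.-1 * sf_eval (fun i => x (k * i)%N) (pi_sf c chi j).

(** A root of order exactly [d] is chosen for each [d]; by [order_sum_indep] the value is the same
    for any order divisible by [d]. *)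
Definition mu_sum d : algC := order_sum (chi d (c d)) d d.

Lemma mu_sum_dvd D : (0 < D)%N -> \sum_(d < D.+1 | (d %| D)%N) mu_sum d = (D == 1%N)%:R.
Proof.
move=> D0; rewrite -(order_sum_dvd (hzeta D0) (dvdnn D)).
apply: eq_bigr => d d_dv; have d0 : (0 < d)%N by apply: dvdn_gt0 d_dv.
exact: order_sum_indep (hzeta d0) (hzeta D0) (dvdnn d) d_dv.
Qed.

(** The powers of the [j]-cycle are grouped by their order [d]. Within a group the cycle type is
    constant, and the character values add up to mu(d). *)
Lemma signed_lie_psumE N j k : (0 < j <= N)%N ->
  j%:R * signed_lie_psum j k =
  \sum_(d < N.+1 | (d %| j)%N)
     mu_sum d * ((-1) ^+ (j %/ d).-1 * x (k * d)%N ^+ (j %/ d)).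
Proof.
case/andP => j0 le_jN; have nz_j : j%:R != 0 :> algC by rewrite pnatr_eq0 -lt0n.
rewrite /signed_lie_psum /pi_sf /Lie sf_eval_omega_frob_cycle ?hc //.
rewrite mulrCA mulVKf // mulr_sumr.
rewrite (partition_big (fun i : 'I_j => inord (j %/ gcdn j i)%N : 'I_N.+1)
  (fun d : 'I_N.+1 => (d %| j)%N)) /=; last first.
  move=> i _; rewrite inordK; first by rewrite dvdn_div ?dvdn_gcdl.
  by rewrite ltnS (leq_trans (leq_div _ _)).
apply: eq_bigr => d d_dv; have d0 : (0 < d)%N by apply: dvdn_gt0 d_dv.
rewrite /mu_sum (order_sum_indep (hzeta d0) (hzeta j0) (dvdnn d) d_dv) mulr_suml.
apply: eq_big => [i | i].
  by rewrite -val_eqE /= inordK // ltnS (leq_trans (leq_div _ _)).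
rewrite -val_eqE /= inordK; last by rewrite ltnS (leq_trans (leq_div _ _)).
move=> /eqP def_d; rewrite (lin_charX (hlin j)) ?cycle_id // mulrCA; congr (_ * _).
have g0 : (0 < gcdn j i)%N by rewrite gcdn_gt0 j0.
have -> : (j %/ d = gcdn j i)%N by rewrite -def_d divnA ?dvdn_gcdl // mulKn.
rewrite def_d mulrA; congr (_ * _); rewrite -exprD.
have le_gj : (gcdn j i <= j)%N by rewrite dvdn_leq ?dvdn_gcdl.
by rewrite signr_pred_addB.
Qed.

Lemma signed_lie_psum1 k : signed_lie_psum 1 k = x k.
Proof.
have := @signed_lie_psumE 1 1 k isT; rewrite mul1r => ->; rewrite big_mkcond !big_ord_recl big_ord0 /=.
rewrite divn1 muln1 addr0 add0r !mul1r.
have := @mu_sum_dvd 1 isT; rewrite big_mkcond !big_ord_recl big_ord0 /= add0r addr0.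
by move=> ->; rewrite mul1r.
Qed.

(** The coefficient is a sum over d m k = M of mu(d) (-1)^(m-1) x(k d)^m. For fixed m, the index k d
    = M / m is constant, so summing mu over the divisors d of M / m leaves only m = M. *)
Lemma coef_sum_lie_logder N M : (0 < M <= N)%N ->
  (\sum_(j <- iota 1 N) j%:R *: (p_series N (signed_lie_psum j) \Po 'X^j))`_M =
  (-1) ^+ M.-1 * x 1%N ^+ M.
Proof.
move=> rg_M; have [M0 le_MN] := andP rg_M; rewrite coef_sum.
pose G d m k := mu_sum d * ((-1) ^+ m.-1 * x (k * d)%N ^+ m).
transitivity (\sum_(j < N.+1 | (j %| M)%N)
    \sum_(d < N.+1 | (d %| j)%N) G d (j %/ d)%N (M %/ j)%N).
  rewrite big_iota1 big_mkcond [RHS]big_mkcond; apply: eq_bigr => j _.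
  case: posnP => [-> | j0]; first by rewrite dvd0n gtn_eqF.
  rewrite coefZ coef_comp_poly_Xn //; case: ifP => j_dv; last by rewrite mulr0.
  rewrite coef_p_series divn_gt0 // dvdn_leq // (leq_trans (leq_div _ _)) //=.
  by rewrite (@signed_lie_psumE N) // j0 -ltnS /=.
rewrite big_divisor_assoc //.
transitivity (\sum_(m < N.+1 | (m %| M)%N)
    (if m == M :> nat then (-1) ^+ M.-1 * x 1%N ^+ M else 0)).
  apply: eq_bigr => m m_dv; have m0 : (0 < m)%N by apply: dvdn_gt0 m_dv.
  pose D := (M %/ m)%N; have D0 : (0 < D)%N by rewrite divn_gt0 // dvdn_leq.
  have le_DN : (D <= N)%N by rewrite (leq_trans (leq_div _ _)).
  transitivity ((D == 1%N)%:R * ((-1) ^+ m.-1 * x D ^+ m)).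
    rewrite -mu_sum_dvd // mulr_suml /G -/D.
    rewrite (big_ord_widen_cond N.+1 (fun d => (d %| D)%N)
      (fun d => mu_sum d * ((-1) ^+ m.-1 * x D ^+ m))) //.
    apply: eq_big => [d | d d_dv]; last by rewrite divnK.
    by case: (boolP (d %| D)%N) => //= d_dv; rewrite ltnS dvdn_leq.
  have -> : (D == 1%N) = (m == M :> nat).
    by rewrite -(eqn_pmul2r m0) divnK // mul1n eq_sym.
  case: eqP => [def_m | _]; last by rewrite mul0r.
  by rewrite mul1r /D def_m divnn M0.
have lt_M : (M < N.+1)%N by [].
rewrite (bigD1 (Ordinal lt_M)) //= eqxx big1 ?addr0 // => m /andP[_].
by rewrite -val_eqE /= => /negbTE->.
Qed.

Lemma coef_prod_signed_lie n : (2 <= n)%N ->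
  (\prod_(j <- iota 2 n.-1) (h_series n (signed_lie_psum j) \Po 'X^j))`_n =
  h_of_p (fun k => - x k) n + x 1%N * h_of_p (fun k => - x k) n.-1.
Proof.
move=> le2n; pose P j := j%:R *: (p_series n (signed_lie_psum j) \Po 'X^j).
pose L := p_series n (fun k => (-1) ^+ k.-1 * x 1%N ^+ k).
pose Q := \sum_(j <- iota 2 n.-1) P j.
set A := \prod_(j <- _) _.
pose B := (1 + x 1%N *: 'X) * h_series n (fun k => - x k).
have logderA : logder_upto n Q A.
  rewrite /Q /A big_seq [X in logder_upto _ _ X]big_seq.
  rewrite big_mkcond [X in logder_upto _ _ X]big_mkcond.
  apply: logder_prod => j; case: ifP; last by move=> _; apply: logder1.
  rewrite mem_iota => /andP[/ltnW j0 _]; apply: logder_comp => //.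
  exact: logder_h_series.
have QE i : (i <= n)%N -> Q`_i = (L + p_series n (fun k => - x k))`_i.
  have P1 : P 1%N = p_series n x.
    rewrite /P scale1r expr1 comp_polyXr /p_series.
    by apply: eq_bigr => k _; rewrite signed_lie_psum1.
  (* Restoring the factor [j = 1], which contributes the power sums themselves, makes the full
     divisor sum available. *)
  have -> : Q = \sum_(j <- iota 1 n) P j - p_series n x.
    have -> : iota 1 n = 1%N :: iota 2 n.-1 by case: (n) le2n.
    by rewrite big_cons P1 addrAC subrr add0r.
  (* [coef_sum_lie_logder] covers positive degrees only; all constant terms are zero. *)
  rewrite p_seriesN /L !coefB; case: (posnP i) => [-> _ | i0 le_in].
    rewrite !coef_p_series subr0 coef_sum big_seq big1 ?subr0 // => j.
    rewrite mem_iota => /andP[j0 _].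
    by rewrite coefZ coef_comp_poly_Xn // dvdn0 div0n coef_p_series mulr0.
  by rewrite coef_sum_lie_logder ?i0 // /L !coef_p_series i0 le_in.
have logderB : logder_upto n Q B.
  apply: (@logder_eq _ n (L + p_series n (fun k => - x k)) Q B B).
  - by move=> i le_in; rewrite coefB QE // subrr.
  - by rewrite subrr; apply: vanish_upto0.
  by apply: logderM; [apply: logder_linear | apply: logder_h_series].
rewrite (logder_inj _ _ logderA logderB) //.
- rewrite /B mulrDl mul1r -scalerAl coefD coefZ coefXM !coef_h_series ?leq_pred //.
  by case: (n) le2n.
- by rewrite QE // coefD !coef_p_series addr0.
rewrite /B coefM big_ord1 /= coefD coefZ coefX mulr0 addr0 coef1 mul1r.
rewrite coef_h_series // h_of_p0 /A.
have coef0_prod : {morph (fun p : {poly algC} => p`_0) : p q / p * q} by exact: coef0M.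
rewrite (big_morph _ coef0_prod (coef1 _ 0)) big_seq big1 // => j.
rewrite mem_iota => /andP[/ltnW j0 _]; rewrite (coef_comp_poly_Xn _ _ j0).
by rewrite dvdn0 div0n coef_h_series // h_of_p0.
Qed.

Lemma sum_signed_chW n : (2 <= n)%N ->
  \sum_(la <- partitions n | 1%N \notin la)
     (-1) ^+ Defs.rank la * sf_eval x (chW c chi n la) =
  (\prod_(j <- iota 2 n.-1) (h_series n (signed_lie_psum j) \Po 'X^j))`_n.
Proof.
move=> le2n.
(* The exclusion of parts equal to 1 is encoded as a weight that kills every positive multiplicity
   of 1. *)
pose f j m : algC := if j == 1%N then (m == 0%N)%:R else h_of_p (signed_lie_psum j) m.
transitivity (\sum_(la <- partitions n) \prod_(j <- iota 1 n) f j (count_mem j la)).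
  rewrite big_mkcond big_seq [RHS]big_seq; apply: eq_bigr => la /mem_partitions[_ in_la].
  have [la1 | la'1] /= := boolP (1%N \in la).
    rewrite (bigD1_seq 1%N) ?mem_iota ?iota_uniq ?ltnS ?(ltnW le2n) //=.
    have cnt : (0 < count_mem 1%N la)%N by rewrite -has_count has_pred1.
    by rewrite /f eqxx gtn_eqF // mul0r.
  rewrite rank_prod; last by move=> k /in_la/andP[].
  rewrite (prod_exp_count _ in_la) /chW sf_eval_prod -big_split big_seq [RHS]big_seq.
  apply: eq_bigr => j; rewrite mem_iota => /andP[j0 _].
  rewrite /= -exprM sf_eval_signed_pleth // -/(signed_lie_psum j) /f.
  by case: eqP => // ->; rewrite (count_memPn la'1) h_of_p0.
rewrite (@sum_partitions _ n) //; congr ((_ : {poly algC})`_n).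
case: (n) le2n => // m _; rewrite [iota 1 _]/= big_cons.
rewrite big_ord_recl big1 ?addr0 /f /= => [|i _]; last by rewrite scale0r.
rewrite mul0n expr0 scale1r mul1r big_seq [RHS]big_seq.
apply: eq_bigr => j; rewrite mem_iota => /andP[j2 _].
by rewrite h_series_comp gtn_eqF.
Qed.

End LiePowerSums.

(** At least one part is present. Hence the ranks below [n] exhaust the alternating sum. *)
Lemma rank_lt n la : (0 < n)%N -> la \in partitions n -> (Defs.rank la < n)%N.
Proof.
move=> n0 /mem_partitions[sum_la _]; rewrite /Defs.rank sum_la.
by case: la sum_la n0 => [<- // | i la _ n0]; rewrite ltn_subrL n0.
Qed.

Lemma sf_eval_alternating_chWhat x (c : forall j, 'S_j) (chi : forall j, 'CF(<[c j]>)) n :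
  (0 < n)%N ->
  sf_eval x (sf_sum [seq sf_scale ((-1) ^+ i) (chWhat c chi n i) | i <- iota 0 n]) =
  \sum_(la <- partitions n | 1%N \notin la)
     (-1) ^+ Defs.rank la * sf_eval x (chW c chi n la).
Proof.
move=> n0; rewrite sf_eval_sum.
transitivity (\sum_(i < n) \sum_(la <- partitions n | (1%N \notin la) && (Defs.rank la == i))
    (-1) ^+ Defs.rank la * sf_eval x (chW c chi n la)).
  rewrite -(big_mkord predT (fun i => \sum_(la <- partitions n |
    (1%N \notin la) && (Defs.rank la == i))
      (-1) ^+ Defs.rank la * sf_eval x (chW c chi n la))) /index_iota subn0.
  apply: eq_bigr => i _; rewrite sf_eval_scale sf_eval_sum big_filter mulr_sumr.
  by apply: eq_bigr => la /andP[_ /eqP->].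
rewrite (exchange_big_dep (fun la : seq nat => 1%N \notin la)) /=; last by move=> i la _ /andP[].
rewrite big_seq_cond [RHS]big_seq_cond; apply: eq_bigr => la /andP[la_n la'1].
rewrite (big_pred1 (Ordinal (rank_lt n0 la_n))) // => i.
by rewrite la'1 /= eq_sym.
Qed.

Unset Implicit Arguments.
Set Strict Implicit.

Theorem theorem1p6 (n : nat) (c : forall j, 'S_j) (chi : forall j, 'CF(<[c j]>))
  (hn : (2 <= n)%N)
  (hc : forall j, (0 < j)%N -> #|porbits (c j)| = 1%N)
  (hlin : forall j, chi j \is a linear_char)
  (hzeta : forall j, (0 < j)%N -> j.-primitive_root (chi j (c j))) :
  sf_eq (sf_sum [seq sf_scale ((-1) ^+ i) (chWhat c chi n i) | i <- iota 0 n])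
        (sf_scale ((-1) ^+ (n - 1)) (schur (2%N :: nseq (n - 2) 1%N))).
Proof.
apply: sf_eq_eval => x.
rewrite sf_eval_alternating_chWhat ?(ltnW hn) // sum_signed_chW //.
by rewrite (coef_prod_signed_lie hc hlin hzeta) // sf_eval_scale sf_eval_schur_hook.
Qed.
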